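(* Consider $\min_x f(x)+\sum_{i=1}^M g_i(x_i)$ s.t. $Ax:=\sum_{i=1}^M A_ix_i=b$, where $f$ is convex and differentiable with $\nabla f$ Lipschitz continuous with modulus $L_f$, each $g_i$ is proper closed convex, $g(x)=\sum_i g_i(x_i)$ is strongly convex with modulus $\mu>0$, and there exists a KKT point $(x^*,\lambda^* )$. Let $\{(x^k,\lambda^k)\}_{k\ge1}$ be generated by the accelerated proximal Jacobian ADMM (see context) with parameters $$\beta_k=\rho_k=k\beta,\qquad P^k=kP+L_fI,\qquad\forall k\ge1,$$ where $\beta>0$ and $P$ is a (symmetric) block diagonal matrix satisfying $0\prec P-\beta A^\top A\preceq\frac{\mu}{2}I$. Let $k_0=\frac{2L_f}{\mu}$ and $$\phi_1(x,\lambda)=\frac{k_0+2}{2\rho_1}\|\lambda-\lambda^1\|^2+\frac{k_0+2}{2}\|x^1-x\|^2_{P^1-\beta_1A^\top A}.$$ Then for every $t\ge1$, $$\max\left\{\beta\|r^{t+1}\|^2,\ \|x^{t+1}-x^*\|^2_{P-\beta A^\top A}\right\}\le\frac{2}{t(t+k_0+1)}\phi_1(x^*,\lambda^* ).$$ In addition, letting $\gamma=\max\{2\|\lambda^*\|,1+\|\lambda^*\|\}$ and $$T=\frac{t(t+2k_0+3)}{2},\qquad \bar x^{t+1}=\frac{\sum_{k=1}^t(k+k_0+1)x^{k+1}}{T},$$ we have $$|F(\bar x^{t+1})-F(x^* )|\le\frac1T\max_{\|\lambda\|\le\gamma}\phi_1(x^*,\lambda),\qquad \|A\bar x^{t+1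}-b\|\le\frac{1}{T\max\{1,\|\lambda^*\|\}}\max_{\|\lambda\|\le\gamma}\phi_1(x^*,\lambda).$$
   Context: The variable $x=(x_1,\dots,x_M)$ is partitioned into $M$ disjoint blocks and $A=[A_1,\dots,A_M]$. $g_i$ may be extended-valued. $F=f+g$. A point $(x^*,\lambda^* )$ is a KKT point if $0\in\partial F(x^* )-A^\top\lambda^*$ and $Ax^*=b$. For a symmetric matrix $W$, $\|v\|_W^2=v^\top Wv$; $\|\cdot\|$ is the Euclidean norm. Accelerated proximal Jacobian ADMM: choose $x^1$, set $\lambda^1=0$, $r^1=Ax^1-b$. For $k=1,2,\dots$, with scalars $\beta_k,\rho_k$ and a symmetric PSD block diagonal matrix $P^k$ with diagonal blocks $P_1^k,\dots,P_M^k$, do $$x_i^{k+1}=\arg\min_{x_i}\ \langle\nabla_if(x^k)-A_i^\top(\lambda^k-\beta_kr^k),x_i\rangle+g_i(x_i)+\tfrac12\|x_i-x_i^k\|^2_{P_i^k},\quad i=1,\dots,M,$$ $$r^{k+1}=Ax^{k+1}-b,\qquad \lambda^{k+1}=\lambda^k-\rho_kr^{k+1}.$$ Here $\nabla_i f$ is the partial gradient with respect to $x_i$. *)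

(* Defs.v *)
From HB Require Import structures.
From mathcomp Require Import all_boot all_order all_algebra.
From mathcomp Require Import all_classical all_reals all_analysis.

Set Implicit Arguments.
Unset Strict Implicit.
Unset Printing Implicit Defensive.

Import Order.TTheory GRing.Theory Num.Theory.
Import numFieldNormedType.Exports.

Local Open Scope classical_set_scope.
Local Open Scope ring_scope.

Definition inner (R : realType) (n : nat) (u v : 'cV[R]_n) : R :=
  (u^T *m v) 0 0.

(* The library norm `|v| on matrices is the max norm; the Euclidean norm is
   needed here.  Topological notions (closed, differentiable) are the same for
   both. *)
Definition enorm (R : realType) (n : nat) (v : 'cV[R]_n) : R :=
  Num.sqrt (inner v v).

(* ||v||_W^2, for W not necessarily positive semidefinite *)
Definition wnorm2 (R : realType) (n : nat) (W : 'M[R]_n) (v : 'cV[R]_n) : R :=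
  (v^T *m W *m v) 0 0.

Definition posdef_mx (R : realType) (n : nat) (W : 'M[R]_n) : Prop :=
  W^T = W /\ forall v : 'cV[R]_n, v != 0 -> 0 < wnorm2 W v.

Definition possemidef_mx (R : realType) (n : nat) (W : 'M[R]_n) : Prop :=
  W^T = W /\ forall v : 'cV[R]_n, 0 <= wnorm2 W v.

Definition lt_mx (R : realType) (n : nat) (V W : 'M[R]_n) : Prop :=
  posdef_mx (W - V).

Definition le_mx (R : realType) (n : nat) (V W : 'M[R]_n) : Prop :=
  possemidef_mx (W - V).

Definition grad (R : realType) (n : nat) (f : 'cV[R]_n -> R) (x : 'cV[R]_n) :
    'cV[R]_n :=
  \col_j 'D_(delta_mx j 0) f x.

Definition lipschitz_grad (R : realType) (n : nat) (f : 'cV[R]_n -> R) (L : R) :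
    Prop :=
  0 <= L /\ forall x y, enorm (grad f x - grad f y) <= L * enorm (x - y).

Definition proper_fun (R : realType) (n : nat) (h : 'cV[R]_n -> \bar R) : Prop :=
  (forall x, (-oo < h x)%E) /\ exists x, (h x < +oo)%E.

Definition closed_fun (R : realType) (n : nat) (h : 'cV[R]_n -> \bar R) : Prop :=
  closed [set p : 'cV[R]_n * R | (h p.1 <= p.2%:E)%E].

Definition econvex_fun (R : realType) (n : nat) (h : 'cV[R]_n -> \bar R) : Prop :=
  forall (x y : 'cV[R]_n) (t : R), 0 < t < 1 ->
    (h (t *: x + (1 - t)%R *: y)%R <= t%:E * h x + (1 - t)%:E * h y)%E.

Definition strongly_convex_fun (R : realType) (n : nat) (mu : R)
    (h : 'cV[R]_n -> \bar R) : Prop :=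
  forall (x y : 'cV[R]_n) (t : R), 0 < t < 1 ->
    (h (t *: x + (1 - t)%R *: y)%R
       + (mu / 2 * (t * (1 - t)) * enorm (x - y)%R ^+ 2)%:E
     <= t%:E * h x + (1 - t)%:E * h y)%E.

Definition subdiff (R : realType) (n : nat) (h : 'cV[R]_n -> \bar R)
    (x : 'cV[R]_n) : set 'cV[R]_n :=
  [set v | forall y, (h x + (inner v (y - x)%R)%:E <= h y)%E].

Definition argmin (R : realType) (n : nat) (h : 'cV[R]_n -> \bar R) :
    set 'cV[R]_n :=
  [set x | forall y, (h x <= h y)%E].

Definition is_max (R : realType) (S : set R) (v : R) : Prop :=
  S v /\ ubound S v.

(* A vector x with M blocks of sizes n 0, ..., n (M - 1) is an element of
   'cV_(\sum_i n i), and its block x_i is submxcol x i. *)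
Definition sepsum (R : realType) (M : nat) (n : 'I_M -> nat)
    (g : forall i, 'cV[R]_(n i) -> \bar R) (x : 'cV[R]_(\sum_i n i)) : \bar R :=
  (\sum_(i < M) g i (submxcol x i))%E.

Definition objective (R : realType) (M : nat) (n : 'I_M -> nat)
    (f : 'cV[R]_(\sum_i n i) -> R) (g : forall i, 'cV[R]_(n i) -> \bar R)
    (x : 'cV[R]_(\sum_i n i)) : \bar R :=
  ((f x)%:E + sepsum g x)%E.

Definition kkt_point (R : realType) (m n : nat) (F : 'cV[R]_n -> \bar R)
    (A : 'M[R]_(m, n)) (b : 'cV[R]_m) (x : 'cV[R]_n) (lam : 'cV[R]_m) : Prop :=
  [set v - A^T *m lam | v in subdiff F x] 0 /\ A *m x = b.

Definition residual (R : realType) (m n : nat) (A : 'M[R]_(m, n))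
    (b : 'cV[R]_m) (x : nat -> 'cV[R]_n) (k : nat) : 'cV[R]_m :=
  A *m x k - b.

(* Sequences are indexed from 1; their values at 0 are irrelevant.  P k i is
   the diagonal block P_i^k, and submxcol (grad f (x k)) i is the partial
   gradient of f with respect to x_i at x^k. *)
Definition proximal_jacobian_admm (R : realType) (M m : nat) (n : 'I_M -> nat)
    (f : 'cV[R]_(\sum_i n i) -> R) (g : forall i, 'cV[R]_(n i) -> \bar R)
    (A : forall i, 'M[R]_(m, n i)) (b : 'cV[R]_m)
    (beta rho : nat -> R) (P : nat -> forall i, 'M[R]_(n i))
    (x : nat -> 'cV[R]_(\sum_i n i)) (lam : nat -> 'cV[R]_m) : Prop :=
  let r := residual (\mxrow_i A i) b x in
  [/\ lam 1%N = 0,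
      (forall k, (1 <= k)%N -> forall i,
         argmin (fun z : 'cV[R]_(n i) =>
           ((inner (submxcol (grad f (x k)) i
                    - (A i)^T *m (lam k - beta k *: r k)) z)%:E
            + g i z
            + (1 / 2 * wnorm2 (P k i) (z - submxcol (x k) i))%:E)%E)
           (submxcol (x k.+1) i)) &
      (forall k, (1 <= k)%N -> lam k.+1 = lam k - rho k *: r k.+1)].

(* Main.v *)
(* One iteration, at a feasible point [x] and any multiplier [l], combines the
   descent lemma for [f], strong convexity of [g] in the proximal subproblem and
   the three-point identity into an estimate of
   [F x_{k+1} - F x - <l, r_{k+1}>].  Since [rho_k = beta_k], only the matrix
   [k Q + L I], with [Q = P - beta A^T A], remains in it.  With the weights
   [w_k = k + k0 + 1] the estimates telescope: the growth of
   [w_k (k Q + L I)] costs at most [w_k mu I], because [Q <= (mu / 2) I] and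
   [L = k0 mu / 2], and strong convexity provides exactly that.  At the
   KKT multiplier every gap is nonnegative, which gives the nonergodic rates;
   Jensen's inequality with varying [l] gives the ergodic ones. *)
Require Import Defs.
From HB Require Import structures.
From mathcomp Require Import all_boot all_order all_algebra.
From mathcomp Require Import all_classical all_reals all_analysis.
From mathcomp Require Import ring lra.

Set Implicit Arguments.
Unset Strict Implicit.
Unset Printing Implicit Defensive.

Import Order.TTheory GRing.Theory Num.Theory.
Import numFieldNormedType.Exports.

Local Open Scope classical_set_scope.
Local Open Scope ring_scope.

(** * Euclidean inner product and quadratic forms *)

Section Inner.
Context {R : realType}.

Lemma innerE n (u v : 'cV[R]_n) : inner u v = \sum_i u i 0 * v i 0.
Proof. by rewrite /inner mxE; apply: eq_bigr => i _; rewrite mxE. Qed.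

Lemma innerC n (u v : 'cV[R]_n) : inner u v = inner v u.
Proof. by rewrite !innerE; apply: eq_bigr => i _; rewrite mulrC. Qed.

Lemma innerDr n (u v w : 'cV[R]_n) : inner u (v + w) = inner u v + inner u w.
Proof. by rewrite /inner mulmxDr mxE. Qed.

Lemma innerZr n a (u v : 'cV[R]_n) : inner u (a *: v) = a * inner u v.
Proof. by rewrite /inner -scalemxAr mxE. Qed.

Lemma innerNr n (u v : 'cV[R]_n) : inner u (- v) = - inner u v.
Proof. by rewrite /inner mulmxN mxE. Qed.

Lemma innerDl n (u v w : 'cV[R]_n) : inner (u + v) w = inner u w + inner v w.
Proof. by rewrite innerC innerDr !(innerC w). Qed.

Lemma innerZl n a (u v : 'cV[R]_n) : inner (a *: u) v = a * inner u v.
Proof. by rewrite innerC innerZr innerC. Qed.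

Lemma innerNl n (u v : 'cV[R]_n) : inner (- u) v = - inner u v.
Proof. by rewrite innerC innerNr innerC. Qed.

Definition innerBE := (innerDr, innerDl, innerNr, innerNl, innerZr, innerZl).

Lemma inner_mull m n (A : 'M[R]_(m, n)) (u : 'cV[R]_n) (v : 'cV[R]_m) :
  inner (A *m u) v = inner u (A^T *m v).
Proof. by rewrite /inner trmx_mul mulmxA. Qed.

Lemma inner_ge0 n (u : 'cV[R]_n) : 0 <= inner u u.
Proof. by rewrite innerE sumr_ge0 // => i _; rewrite -expr2 sqr_ge0. Qed.

Lemma inner_eq0 n (u : 'cV[R]_n) : (inner u u == 0) = (u == 0).
Proof.
apply/idP/eqP => [|->]; last by rewrite /inner mulmx0 mxE.
rewrite innerE psumr_eq0 => [/allP h|i _]; last by rewrite -expr2 sqr_ge0.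
apply/colP => i; rewrite mxE; apply/eqP.
by have := h i (mem_index_enum _); rewrite mulf_eq0 orbb.
Qed.

Lemma enorm_ge0 n (u : 'cV[R]_n) : 0 <= enorm u.
Proof. exact: sqrtr_ge0. Qed.

Lemma enorm_sqr n (u : 'cV[R]_n) : enorm u ^+ 2 = inner u u.
Proof. by rewrite sqr_sqrtr // inner_ge0. Qed.

Lemma enormZ n a (u : 'cV[R]_n) : enorm (a *: u) = `|a| * enorm u.
Proof.
by rewrite /enorm innerZr innerZl mulrA -expr2 sqrtrM ?sqr_ge0 // sqrtr_sqr.
Qed.

Lemma enormN n (u : 'cV[R]_n) : enorm (- u) = enorm u.
Proof. by rewrite /enorm innerNr innerNl opprK. Qed.

(** Cauchy-Schwarz: the squared norm of [inner v v *: u - inner u v *: v] is nonnegative and carries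
    a factor [inner v v], positive when [v] is nonzero. *)
Lemma inner_le_enorm n (u v : 'cV[R]_n) : inner u v <= enorm u * enorm v.
Proof.
have [v0|v0] := eqVneq v 0.
  by rewrite v0 /inner mulmx0 mxE mulr_ge0 ?enorm_ge0.
have vv : 0 < inner v v by rewrite lt0r inner_eq0 v0 inner_ge0.
suff h : inner u v ^+ 2 <= inner u u * inner v v.
  rewrite /enorm -sqrtrM ?inner_ge0 //.
  apply: (le_trans (ler_norm _)).
  by rewrite -sqrtr_sqr ler_wsqrtr.
have := inner_ge0 (inner v v *: u - inner u v *: v).
rewrite !innerBE (innerC v u) => h.
rewrite -subr_ge0 -(pmulr_rge0 _ vv).
by move: h; congr (_ <= _); ring.
Qed.

Lemma wnorm2E n (W : 'M[R]_n) (v : 'cV[R]_n) : wnorm2 W v = inner v (W *m v).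
Proof. by rewrite /wnorm2 /inner mulmxA. Qed.

Lemma wnorm2_affine n (W : 'M[R]_n) (a c : R) (v : 'cV[R]_n) :
  wnorm2 (a *: W + c%:M) v = a * wnorm2 W v + c * inner v v.
Proof.
by rewrite !wnorm2E mulmxDl mul_scalar_mx -scalemxAl innerDr !innerZr.
Qed.

Lemma wnorm2B n (U V : 'M[R]_n) (v : 'cV[R]_n) :
  wnorm2 (U - V) v = wnorm2 U v - wnorm2 V v.
Proof. by rewrite !wnorm2E mulmxBl innerDr innerNr. Qed.

Lemma inner_symmx n (W : 'M[R]_n) (u v : 'cV[R]_n) :
  W^T = W -> inner u (W *m v) = inner v (W *m u).
Proof. by move=> WT; rewrite innerC inner_mull WT. Qed.

(** Symmetry of [W] merges the cross terms. This turns the proximal inner product into differences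
    of squared distances, which can telescope. *)
Lemma wnorm2_three_points n (W : 'M[R]_n) (x y z : 'cV[R]_n) : W^T = W ->
  inner (W *m (y - x)) (z - y) =
  (wnorm2 W (x - z) - wnorm2 W (y - z) - wnorm2 W (y - x)) / 2.
Proof.
move=> WT; rewrite !wnorm2E !mulmxBr !innerBE.
have s := inner_symmx _ _ WT.
rewrite !(innerC (W *m _)) (s z x) (s y x) (s z y).
by field.
Qed.

End Inner.

(** * Smooth convex functions *)

Section SmoothConvex.
Context {R : realType} {n : nat}.
Variable f : 'cV[R]_n -> R.
Hypothesis fd : forall z, differentiable f z.

(** [grad] collects only partial derivatives; linearity of the differential, with [d] expanded over
    the coordinate vectors, reaches every direction. *)
Lemma derive_grad (z d : 'cV[R]_n) : 'D_d f z = inner (grad f z) d.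
Proof.
rewrite deriveE // {1}[d]matrix_sum_delta raddf_sum innerE.
apply: eq_bigr => i _.
rewrite big_ord1 mxE deriveE // mulrC.
exact: (linearZ_LR ('d f z) (d i ord0) (delta_mx i ord0)).
Qed.

Lemma is_derive_line (x d : 'cV[R]_n) (s : R) :
  is_derive s (1 : R) (fun a : R => f (x + a *: d))
    (inner (grad f (x + s *: d)) d).
Proof.
have E : (fun h : R => h^-1 *:
    (((fun a : R => f (x + a *: d)) \o shift s) (h *: (1 : R))
      - f (x + s *: d))) =
  (fun h : R => h^-1 *: ((f \o shift (x + s *: d)) (h *: d) - f (x + s *: d))).
  apply/funext => h /=; congr (_ *: (f _ - _)).
  by rewrite -[h *: 1]/(h * 1) mulr1 scalerDl addrCA.
have df : derivable f (x + s *: d) d by exact: diff_derivable.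
split; first by rewrite /derivable E.
by rewrite /derive E -derive_grad.
Qed.

Lemma descent_lemma L (x y : 'cV[R]_n) : lipschitz_grad f L ->
  f y <= f x + inner (grad f x) (y - x) + L / 2 * enorm (y - x) ^+ 2.
Proof.
move=> [L0 fL]; set d := y - x.
pose c := inner (grad f x) d; pose q := L / 2 * enorm d ^+ 2.
pose F (s : R) := f (x + s *: d).
(* [h] is nonincreasing on [0, 1], and [h 1 <= h 0] is the claim. *)
pose h : R -> R :=
  F - c *: (id : R -> R) - q *: ((id : R -> R) * (id : R -> R)).
have hE s : h s = F s - c * s - q * (s * s) by [].
pose dh (s : R) : R := inner (grad f (x + s *: d)) d - c - 2 * s * q.
have hd s : is_derive s (1 : R) h (dh s).
  have Fs : is_derive s (1 : R) F (inner (grad f (x + s *: d)) d).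
    exact: is_derive_line.
  apply: is_derive_eq; rewrite /dh /GRing.scale /=; ring.
have [] := @MVT_segment _ h dh 0 1 ler01 (fun s _ => hd s).
  apply: derivable_within_continuous => s _.
  exact: (@ex_derive _ _ _ _ _ _ _ (hd s)).
move=> s; rewrite in_itv /= => /andP[s0 s1]; rewrite subr0 mulr1.
(* Cauchy-Schwarz and the Lipschitz bound at distance [s * enorm d] give at most
   [s * L * enorm d ^+ 2], which is [2 * s * q]. *)
have : dh s <= 0.
  rewrite /dh /c -innerNl -innerDl.
  have := inner_le_enorm (grad f (x + s *: d) - grad f x) d.
  have := fL (x + s *: d) x.
  rewrite addrAC subrr add0r enormZ ger0_norm // => h1 h2.
  have := ler_wpM2r (enorm_ge0 d) h1; rewrite innerDl innerNl in h2 *.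
  by rewrite /q; lra.
rewrite !hE /F /dh scale1r scale0r addr0 {1}/d addrCA subrr addr0.
by rewrite /q -/c; lra.
Qed.

Lemma convex_function_conv_le (x y : 'cV[R]_n) (t : R) :
  convex_function setT f -> 0 <= t <= 1 ->
  f (t *: x + (1 - t) *: y) <= t * f x + (1 - t) * f y.
Proof.
move=> fc /andP[t0 t1].
by have := fc (Itv01 t0 t1) x y (in_setT _) (in_setT _); rewrite convRE.
Qed.

(** For steps in (0, 1], convexity bounds the difference quotient from [x] towards [y] by
    [f y - f x]; the bound passes to the right limit. *)
Lemma convex_grad_le (x y : 'cV[R]_n) : convex_function setT f ->
  f x + inner (grad f x) (y - x) <= f y.
Proof.
move=> fc; set d := y - x; rewrite -lerBrDl -derive_grad.
have /cvg_dnbhs_at_right df : derivable f x d by exact: diff_derivable.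
apply: (cvgr_to_le df).
near=> h.
have h0 : 0 < h by near: h; exact: nbhs_right_gt.
have h1 : h <= 1 by near: h; exact: nbhs_right_le.
have h01 : 0 <= h <= 1 by rewrite h1 ltW.
have := convex_function_conv_le y x fc h01.
have -> : h *: y + (1 - h) *: x = h *: d + x.
  by rewrite scalerBr scalerBl scale1r addrAC addrA.
move=> fh; rewrite -[X in X <= _]/(h^-1 * (f (h *: d + x) - f x)).
rewrite mulrC ler_pdivrMr //.
lra.
Unshelve. all: by end_near. Qed.

End SmoothConvex.

(** * The proximal step *)

Section Prox.
Context {R : realType}.

(** Real upper bounds [a] and [b] in place of the extended values keep the right-hand side in the
    reals. *)
Lemma strongly_convex_le n mu (h : 'cV[R]_n -> \bar R) x y a b (t : R) :
  strongly_convex_fun mu h -> 0 < t < 1 ->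
  (h x <= a%:E)%E -> (h y <= b%:E)%E ->
  (h (t *: x + (1 - t) *: y)%R <=
    (t * a + (1 - t) * b - mu / 2 * (t * (1 - t)) * enorm (x - y) ^+ 2)%:E)%E.
Proof.
move=> hc t01 hx hy; rewrite EFinB leeBrDr //.
apply: (le_trans (hc _ _ _ t01)); case/andP: t01 => t0 t1.
rewrite [leRHS]EFinD !EFinM leeD // lee_wpmul2l // lee_fin ?subr_ge0 ltW //.
Qed.

Lemma ge0_of_affine (a c : R) :
  (forall s, 0 < s < 1 -> 0 <= a + s * c) -> 0 <= a.
Proof.
move=> h; apply/ler_addgt0Pl => e e0.
have c1 : 0 < `|c| + 1 by rewrite ltr_wpDl.
(* The second bound forces [s * c <= e], the first keeps [s] below 1, and the added 1 covers
   [c = 0]. *)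
pose s := Num.min (1 / 2) (e / (`|c| + 1)).
have s0 : 0 < s by rewrite lt_min !divr_gt0.
have s1 : s < 1 by rewrite gt_min; apply/orP; left; lra.
have s01 : 0 < s < 1 by rewrite s0 s1.
apply: (le_trans (h s s01)); rewrite addrC lerD2r.
have : s <= e / (`|c| + 1) by rewrite ge_min lexx orbT.
rewrite ler_pdivlMr // => se.
have := ler_wpM2l (ltW s0) (ler_norm c).
by rewrite mulrDr mulr1 in se; lra.
Qed.

(** First-order optimality without subdifferential calculus: compare [xn] with the point
    [xn + s *: (x - xn)], bound [G] there by strong convexity, divide by [s] and let [s] tend to
    0. *)
Lemma prox_optimality n mu (G : 'cV[R]_n -> \bar R) (W : 'M[R]_n)
    (c xk xn x : 'cV[R]_n) (gn gx : R) :
  W^T = W -> strongly_convex_fun mu G ->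
  argmin (fun z =>
    (inner c z)%:E + G z + (1 / 2 * wnorm2 W (z - xk))%:E)%E xn ->
  G xn = gn%:E -> G x = gx%:E ->
  gn + mu / 2 * enorm (xn - x) ^+ 2
    <= gx + inner (c + W *m (xn - xk)) (x - xn).
Proof.
move=> WT Gc xnmin Gn Gx.
set d := x - xn; set u := xn - xk.
pose e := mu / 2 * enorm d ^+ 2.
have -> : enorm (xn - x) = enorm d by rewrite -enormN opprB.
rewrite -/e -subr_ge0; set a := _ - _.
(* The slope in [s] collects the second-order terms: [e] from the factor s(1-s) of strong convexity,
   and the [W]-quadratic term along [d]. *)
apply: (@ge0_of_affine a (e + 1 / 2 * wnorm2 W d)) => s s01.
have /andP[s0 s1] := s01.
have Gs : (G (s *: x + (1 - s) *: xn)%R <= (s * gx + (1 - s) * gn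
    - mu / 2 * (s * (1 - s)) * enorm d ^+ 2)%:E)%E.
  by apply: strongly_convex_le => //; rewrite ?Gn ?Gx.
have xsE : s *: x + (1 - s) *: xn = xn + s *: d.
  by rewrite scalerBr scalerBl scale1r addrCA.
rewrite xsE in Gs.
have := le_trans (xnmin (xn + s *: d)) (leeD (leeD (lexx _) Gs) (lexx _)).
rewrite Gn -!EFinD lee_fin (addrAC xn) -/u => h.
rewrite -(pmulr_rge0 _ s0).
have WS := inner_symmx d u WT.
(* With transparent [d] and [u], [innerBE] would expand the differences. *)
move: h; rewrite /a; clearbody d u.
rewrite !wnorm2E !mulmxDr -scalemxAr !innerBE WS.
rewrite (innerC (W *m u) d) -WS /e.
lra.
Qed.

End Prox.

(** * One iteration at a feasible point *)

Section Step.
Context {R : realType} {N m : nat}.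
Variables (f : 'cV[R]_N -> R) (G : 'cV[R]_N -> \bar R).
Variables (A : 'M[R]_(m, N)) (b : 'cV[R]_m) (L mu : R).
Hypothesis fc : convex_function setT f.
Hypothesis fd : forall z, differentiable f z.
Hypothesis fL : lipschitz_grad f L.
Hypothesis Gc : strongly_convex_fun mu G.

Lemma admm_step (W : 'M[R]_N) (rho : R) (xk xn x : 'cV[R]_N)
    (lk ln l : 'cV[R]_m) (gn gx : R) :
  let Q := W - rho *: (A^T *m A) in
  W^T = W ->
  argmin (fun z => (inner (grad f xk - A^T *m (lk - rho *: (A *m xk - b))) z)%:E
    + G z + (1 / 2 * wnorm2 W (z - xk))%:E)%E xn ->
  ln = lk - rho *: (A *m xn - b) ->
  G xn = gn%:E -> G x = gx%:E -> A *m x = b ->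
  f xn + gn - (f x + gx) - inner l (A *m xn - b) <=
    inner (ln - l) (A *m xn - b)
    + (wnorm2 Q (xk - x) - wnorm2 Q (xn - x) - wnorm2 Q (xn - xk)) / 2
    + L / 2 * enorm (xn - xk) ^+ 2 - mu / 2 * enorm (xn - x) ^+ 2.
Proof.
move=> Q WT xnmin lnE Gn Gx Ax.
have QT : Q^T = Q by rewrite /Q linearB linearZ /= trmx_mul trmxK WT.
have := prox_optimality WT Gc xnmin Gn Gx.
have := descent_lemma fd xk xn fL.
have := convex_grad_le fd xk x fc.
rewrite -(wnorm2_three_points xk xn x QT).
(* The multiplier update gives lk - rho rk = ln + rho A(xn - xk), so the extra rho A^T A(xn - xk) is
   absorbed by [W], leaving [Q]. *)
have -> : grad f xk - A^T *m (lk - rho *: (A *m xk - b)) + W *m (xn - xk) =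
  grad f xk + Q *m (xn - xk) - A^T *m ln.
  rewrite lnE /Q mulmxBl -scalemxAl -mulmxA !(mulmxBr, scalerBr, =^~scalemxAr).
  rewrite !opprB !addrA.
  apply/colP => i; rewrite !mxE; ring.
have -> : inner (grad f xk + Q *m (xn - xk) - A^T *m ln) (x - xn) =
    inner (grad f xk) (x - xn) + inner (Q *m (xn - xk)) (x - xn)
    + inner ln (A *m xn - b).
  rewrite innerDl innerNl innerDl (innerC (A^T *m ln)) -inner_mull.
  rewrite (mulmxBr A) Ax.
  by rewrite -[b - _]opprB innerNl opprK (innerC _ ln).
rewrite (innerDl ln) (innerNl l) (innerDr _ x) (innerDr _ xn) (innerDr _ x).
rewrite !(innerNr (grad f xk)).
lra.
Qed.

End Step.

(** * Averaging and saddle gaps *)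

Section Ergodic.
Context {R : realType}.

(** Induction on [t]. Convexity is assumed in terms of real upper bounds so that the bound from the
    induction hypothesis can be inserted directly. *)
Lemma jensen_sum n (h : 'cV[R]_n -> \bar R) (w v : nat -> R)
    (y : nat -> 'cV[R]_n) (t : nat) :
  (forall a c x z s, 0 < s < 1 -> (h x <= a%:E)%E -> (h z <= c%:E)%E ->
    (h (s *: x + (1 - s) *: z)%R <= (s * a + (1 - s) * c)%:E)%E) ->
  (forall k, 0 < w k) -> (forall k, (0 < k)%N -> (h (y k) <= (v k)%:E)%E) ->
  (0 < t)%N ->
  let S := \sum_(1 <= k < t.+1) w k in
  (h (S^-1 *: \sum_(1 <= k < t.+1) w k *: y k)%R
    <= (S^-1 * \sum_(1 <= k < t.+1) w k * v k)%:E)%E.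
Proof.
move=> hc w0 hy; case: t => // t _; cbv zeta; elim: t => [|t IH].
  rewrite !big_nat1 scalerA mulrA mulVf ?gt_eqF // scale1r mul1r.
  exact: hy.
rewrite !(big_nat_recr t.+2) //=.
set S' := \sum_(1 <= k < t.+2) w k in IH *.
set X := \sum_(1 <= k < t.+2) w k *: y k in IH *.
set V := \sum_(1 <= k < t.+2) w k * v k in IH *.
set c := w t.+2.
have c0 : 0 < c by exact: w0.
have S0 : 0 < S'.
  rewrite /S' big_nat_recr //= ltr_wpDl // sumr_ge0 // => k _; exact: ltW.
(* The new average is the two-point combination of the old average, with weight [s], and the new
   point. *)
pose s := S' / (S' + c).
have Sc : S' + c != 0 by rewrite gt_eqF // addr_gt0.
have s01 : 0 < s < 1.
  by rewrite divr_gt0 ?addr_gt0 // ltr_pdivrMr ?addr_gt0 // mul1r ltrDl.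
have := hc _ _ _ _ s s01 IH (hy t.+2 isT).
have s'E : 1 - s = (S' + c)^-1 * c by rewrite /s; field.
have sE : s * S'^-1 = (S' + c)^-1 by rewrite /s mulrAC mulfV ?mul1r // gt_eqF.
by rewrite scalerA mulrA s'E sE -!scalerA -scalerDr -mulrA -mulrDr.
Qed.

(** A multiple of a unit vector attains the radius; in dimension 0 the only vector has norm 0, hence
    the weaker form of the claim. It makes the maximum of [phi1] over the ball attained. *)
Lemma exists_enorm_max m (gamma : R) : 0 <= gamma ->
  exists2 l : 'cV[R]_m, enorm l <= gamma &
    forall l' : 'cV[R]_m, enorm l' <= gamma -> enorm l' <= enorm l.
Proof.
move=> g0; case: m => [|m].
  have e0 (l : 'cV[R]_0) : enorm l = 0.
    by rewrite /enorm innerE big_ord0 sqrtr0.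
  by exists 0 => [|l']; rewrite !e0.
have e1 : enorm (delta_mx 0 0 : 'cV[R]_m.+1) = 1.
  rewrite /enorm innerE (bigD1 ord0) //= big1 => [|i /negPf i0].
    by rewrite mxE eqxx mulr1 addr0 sqrtr1.
  by rewrite mxE i0 mul0r.
by exists (gamma *: delta_mx 0 0) => [|l']; rewrite enormZ e1 mulr1 ger0_norm.
Qed.

(* For [a <= C + <l, v>] take [l] antiparallel to [v] with norm [gamma]; since
   [gamma = |ls| + max 1 |ls|], the lower bound [<ls, v> <= a] then leaves the
   slack [max 1 |ls| * |v|]. *)
Lemma saddle_gap_bounds m (v ls : 'cV[R]_m) (a C : R) :
  (forall l, enorm l <= Num.max (2 * enorm ls) (1 + enorm ls) ->
    a - inner l v <= C) ->
  inner ls v <= a ->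
  `|a| <= C /\ enorm v * Num.max 1 (enorm ls) <= C.
Proof.
set s := enorm ls => hC lo; have s0 : 0 <= s := enorm_ge0 ls.
set M := Num.max 1 s.
have gE : Num.max (2 * s) (1 + s) = s + M.
  by rewrite /M addr_maxr maxC; congr Num.max; ring.
have M1 : 1 <= M by rewrite le_max lexx.
have Ms : s <= M by rewrite le_max lexx orbT.
have e0 := enorm_ge0 v.
have h : a + (s + M) * enorm v <= C.
  (* For zero [v] there is no antiparallel direction, and [l = 0] suffices. *)
  have [v0|v0] := eqVneq (enorm v) 0.
    rewrite v0 mulr0; have := hC 0; rewrite /inner trmx0 mul0mx mxE subr0 addr0.
    by apply; rewrite gE /enorm /inner mulmx0 mxE sqrtr0; lra.
  have vp : 0 < enorm v by rewrite lt0r v0.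
  have := hC (- ((s + M) / enorm v) *: v).
  rewrite gE enormZ normrN ger0_norm; last by rewrite divr_ge0 //; lra.
  rewrite divfK // lexx innerZl -enorm_sqr expr2 mulrA mulNr.
  rewrite divfK // mulNr opprK.
  exact.
have h2 : - (s * enorm v) <= a.
  apply: le_trans lo; rewrite lerNl -innerNl.
  by have := inner_le_enorm (- ls) v; rewrite enormN.
have h3 := ler_wpM2r e0 Ms.
have h4 := mulr_ge0 s0 e0.
have h5 : 0 <= M * enorm v by rewrite mulr_ge0 //; lra.
split; last by lra.
by rewrite ler_norml; apply/andP; split; lra.
Qed.

End Ergodic.

(** * Convergence rates *)

Section Rate.
Context {R : realType} {N m : nat}.
Variables (f : 'cV[R]_N -> R) (G : 'cV[R]_N -> \bar R).
Variables (A : 'M[R]_(m, N)) (b : 'cV[R]_m) (L mu beta : R) (P : 'M[R]_N).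
Variables (xs : 'cV[R]_N) (ls : 'cV[R]_m).
Variables (x : nat -> 'cV[R]_N) (lam : nat -> 'cV[R]_m).
Hypothesis fc : convex_function setT f.
Hypothesis fd : forall z, differentiable f z.
Hypothesis fL : lipschitz_grad f L.
Hypothesis mu0 : 0 < mu.
Hypothesis Gc : strongly_convex_fun mu G.
Hypothesis beta0 : 0 < beta.
Hypothesis PT : P^T = P.

Let Q := P - beta *: (A^T *m A).
Let r k := A *m x k - b.
Let k0 := 2 * L / mu.
Let w (k : nat) : R := k%:R + k0 + 1.
(** Real-valued objective: [fine] returns the true value wherever [G] is finite, which includes
    [xs], the iterates from index 2 on, and their averages. *)
Let Fr z := f z + fine (G z).

Hypothesis Q0 : forall v, 0 <= wnorm2 Q v.
Hypothesis Qmu : forall v, wnorm2 Q v <= mu / 2 * inner v v.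
Hypothesis Axs : A *m xs = b.
Hypothesis Gxs : G xs \is a fin_num.
Hypothesis Gx : forall k, (0 < k)%N -> G (x k.+1) \is a fin_num.
Hypothesis kkt : forall z,
  ((Fr xs)%:E + (inner ls (A *m z - b))%:E <= (f z)%:E + G z)%E.
Hypothesis xmin : forall k, (0 < k)%N ->
  argmin (fun z =>
    (inner (grad f (x k) - A^T *m (lam k - (k%:R * beta) *: r k)) z)%:E
    + G z + (1 / 2 * wnorm2 (k%:R *: P + L%:M) (z - x k))%:E)%E (x k.+1).
Hypothesis lamE : forall k, (0 < k)%N ->
  lam k.+1 = lam k - (k%:R * beta) *: r k.+1.

(** The Lyapunov energy; at [k = 1] it is [phi1] at [xs] and [l]. *)
Let E k l := w k / (2 * (k%:R * beta)) * enorm (l - lam k) ^+ 2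
  + w k / 2 * wnorm2 (k%:R *: Q + L%:M) (x k - xs).

Let k00 : 0 <= k0.
Proof. by case: fL => L0 _; rewrite /k0 divr_ge0 ?mulr_ge0 // ltW. Qed.

Let w0 k : 0 < w k.
Proof. by rewrite /w; have := ler0n R k; have := k00; lra. Qed.

(** Dropping the dual and the [L] terms leaves the part that controls the distance to [xs]; it also
    shows that the energy is nonnegative. *)
Let E_ge k l : (0 < k)%N -> k%:R * w k / 2 * wnorm2 Q (x k - xs) <= E k l.
Proof.
move=> k1; rewrite /E wnorm2_affine.
have kR : 0 < k%:R :> R by rewrite ltr0n.
have h1 : 0 <= w k / (2 * (k%:R * beta)) * enorm (l - lam k) ^+ 2.
  by rewrite mulr_ge0 ?sqr_ge0 // divr_ge0 ?mulr_ge0 // ltW.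
have h2 : 0 <= w k / 2 * (L * inner (x k - xs) (x k - xs)).
  have [L0 _] := fL; have := mulr_ge0 L0 (inner_ge0 (x k - xs)).
  by apply: mulr_ge0; rewrite divr_ge0 // ltW.
move: h1 h2; move: (w k) (wnorm2 Q _) (L * inner _ _) => c u v.
move: (c / (2 * _) * _) => a h1 h2; lra.
Qed.

Lemma admm_lyapunov k l : (0 < k)%N ->
  w k * (Fr (x k.+1) - Fr xs - inner l (r k.+1))
    + k%:R * w k / 2 * (beta * enorm (r k.+1) ^+ 2) + E k.+1 l <= E k l.
Proof.
move=> k1; have kR : 0 < k%:R :> R by rewrite ltr0n.
have WT : (k%:R *: P + L%:M)^T = k%:R *: P + L%:M :> 'M[R]_N.
  by rewrite linearD linearZ /= PT tr_scalar_mx.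
have := admm_step fc fd fL Gc l WT (xmin k1) (lamE k1)
  (esym (fineK (Gx k1))) (esym (fineK Gxs)) Axs.
rewrite -/(r k.+1) -/(Fr _) -/(Fr _).
have -> : k%:R *: P + L%:M - (k%:R * beta) *: (A^T *m A) = k%:R *: Q + L%:M.
  by rewrite /Q scalerBr scalerA addrAC.
rewrite !wnorm2_affine -!enorm_sqr.
set D := Fr _ - _ - _; set e := enorm (x k.+1 - x k) ^+ 2.
(* The [L] part of the proximal displacement cancels the descent-lemma error exactly; what remains
   is a multiple of this [Q]-term, with a favourable sign. *)
have q' := Q0 (x k.+1 - x k).
have := Qmu (x k.+1 - xs).
rewrite -enorm_sqr /E !wnorm2_affine -!enorm_sqr.
set q := wnorm2 Q (x k.+1 - xs); set d := enorm (x k.+1 - xs) ^+ 2.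
set y := k%:R * wnorm2 Q (x k - xs) + L * enorm (x k - xs) ^+ 2.
move=> qd step.
have d0 : 0 <= d by exact: sqr_ge0.
(* Once weighted, the cross term accounts for the multiplier term of [step], and the last square
   supplies the residual term. *)
have -> : enorm (l - lam k) ^+ 2 = enorm (l - lam k.+1) ^+ 2
    + 2 * (k%:R * beta) * inner (lam k.+1 - l) (r k.+1)
    + (k%:R * beta) ^+ 2 * enorm (r k.+1) ^+ 2.
  have -> : l - lam k = - (lam k.+1 - l + (k%:R * beta) *: r k.+1).
    by rewrite lamE // addrAC subrK opprB.
  rewrite enormN -[l - _]opprB enormN !enorm_sqr.
  move: (lam k.+1 - l) (r k.+1) => u v.
  by rewrite !innerBE (innerC v u); ring.
set I := inner _ _ in step *; set p := enorm (l - _) ^+ 2.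
set R2 := enorm _ ^+ 2.
have p0 : 0 <= p by exact: sqr_ge0.
have kS : k.+1%:R = k%:R + 1 :> R by rewrite -natr1.
have L_E : L = k0 * mu / 2 by rewrite /k0; field; rewrite gt_eqF.
(* The ratio w_k / k is nonincreasing: w_k (k+1) - w_{k+1} k = k0 + 1. *)
have dual : w k.+1 / (2 * (k.+1%:R * beta)) * p
    <= w k / (2 * (k%:R * beta)) * p.
  apply: ler_wpM2r => //.
  rewrite ler_pdivrMr ?mulr_gt0 ?ltr0n // mulrAC ler_pdivlMr ?mulr_gt0 //.
  have : 0 <= beta * (2 * k0 + 2) by rewrite mulr_ge0 ?ltW //; have := k00; lra.
  by rewrite /w kS; nra.
have expand : w k / (2 * (k%:R * beta))
    * (p + 2 * (k%:R * beta) * I + (k%:R * beta) ^+ 2 * R2)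
  = w k / (2 * (k%:R * beta)) * p + w k * I + k%:R * w k / 2 * (beta * R2).
  by field; rewrite !gt_eqF.
(* Up to the factor 1/2, the coefficient of [q] grows by 2k + k0 + 2 and that of [d] by L = k0 mu /
   2. With q <= (mu/2) d the growth is at most (mu/2)(2k + 2 k0 + 2) d = w_k mu d. *)
have primal : w k.+1 / 2 * (k.+1%:R * q + L * d)
    <= w k / 2 * (k%:R * q + L * d + mu * d).
  have alg (a c u v : R) :
    (2 * c + a + 2) / 2 * u <= (2 * c + a + 2) / 2 * (mu / 2 * v) ->
    (c + 1 + a + 1) / 2 * ((c + 1) * u + a * mu / 2 * v)
      <= (c + a + 1) / 2 * (c * u + a * mu / 2 * v + mu * v) by lra.
  rewrite /w kS L_E; apply: alg; apply: ler_wpM2l qd.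
  have := k00; lra.
have := ler_wpM2l (ltW (w0 k)) step.
have := mulr_ge0 (mulr_ge0 (ltW (w0 k)) (ltW kR)) q'.
rewrite expand; move: dual primal; clearbody I p R2 d q y D e.
move: (w k) (w k.+1) (_ / (2 * (k%:R * beta))) (_ / (2 * (k.+1%:R * beta))).
move=> c c' a a'.
lra.
Qed.

Lemma admm_telescope t l :
  \sum_(1 <= k < t.+1) (w k * (Fr (x k.+1) - Fr xs - inner l (r k.+1))
    + k%:R * w k / 2 * (beta * enorm (r k.+1) ^+ 2)) + E t.+1 l <= E 1 l.
Proof.
elim: t => [|t IH]; first by rewrite big_geq // add0r.
by rewrite big_nat_recr //= -addrA (le_trans _ IH) // lerD2l admm_lyapunov.
Qed.

Lemma admm_gap_ge0 k : (0 < k)%N ->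
  0 <= Fr (x k.+1) - Fr xs - inner ls (r k.+1).
Proof.
move=> k1; have := kkt (x k.+1).
rewrite -(fineK (Gx k1)) -!EFinD lee_fin -/(Fr _) -/(Fr _) /r.
lra.
Qed.

(** At [l = ls] every summand of the telescoped estimate is nonnegative. The last residual term and
    the final energy each give one of the two bounds. *)
Lemma admm_nonergodic_rate t : (0 < t)%N ->
  Num.max (beta * enorm (r t.+1) ^+ 2) (wnorm2 Q (x t.+1 - xs))
    <= 2 / (t%:R * (t%:R + k0 + 1)) * E 1 ls.
Proof.
case: t => // t _.
have tR k : 0 <= k%:R :> R by exact: ler0n.
have term k : 0 <= k%:R * w k / 2 * (beta * enorm (r k.+1) ^+ 2).
  apply: mulr_ge0; last by rewrite mulr_ge0 ?sqr_ge0 // ltW.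
  by rewrite divr_ge0 // mulr_ge0 // ltW.
have := admm_telescope t.+1 ls; have := E_ge ls (ltn0Sn t.+1).
rewrite big_nat_recr //=; set S := \sum_(1 <= k < t.+1) _.
have S0 : 0 <= S.
  rewrite /S big_nat sumr_ge0 // => k /andP[k1 _].
  by rewrite addr_ge0 // mulr_ge0 ?admm_gap_ge0 // ltW.
have := mulr_ge0 (ltW (w0 t.+1)) (admm_gap_ge0 (ltn0Sn t)).
set gap := _ * (Fr (x t.+2) - Fr xs - inner ls (r t.+2)).
have := Q0 (x t.+2 - xs); have := term t.+1.
have := w0 t.+1; have := w0 t.+2; have : w t.+2 = w t.+1 + 1.
  by rewrite /w -[t.+2%:R]natr1; ring.
have : 0 < t.+1%:R :> R by rewrite ltr0n.
rewrite -[t.+2%:R]natr1 -/(w t.+1).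
move: (E 1 ls) (E t.+2 ls) gap (w t.+2) (w t.+1) => e e' {}gap c' c.
move: (wnorm2 _ _) (beta * _) (t.+1%:R) => q u k kp -> c0' c0 u0 q0 gap0 h1 h2.
rewrite ge_max; apply/andP; split; rewrite mulrAC ler_pdivlMr ?mulr_gt0 //.
  have : 0 <= (k + 1) * (c + 1) / 2 * q.
    by rewrite mulr_ge0 // divr_ge0 // mulr_ge0 //; lra.
  lra.
(* The final energy carries the weight (k+1)(c+1), which exceeds the required k c by k + c + 1. *)
have : 0 <= q * (k + c + 1) by rewrite mulr_ge0 //; lra.
lra.
Qed.

Hypothesis GNy : forall z, (-oo < G z)%E.

Let Fconv (a c : R) y z s : 0 < s < 1 ->
  ((f y)%:E + G y <= a%:E)%E -> ((f z)%:E + G z <= c%:E)%E ->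
  ((f (s *: y + (1 - s) *: z))%:E + G (s *: y + (1 - s) *: z)
    <= (s * a + (1 - s) * c)%:E)%E.
Proof.
move=> s01; have /andP[s0 s1] := s01.
rewrite -!leeBrDl // -!EFinB => hy hz.
apply: (le_trans (strongly_convex_le Gc s01 hy hz)); rewrite lee_fin.
have s01' : 0 <= s <= 1 by rewrite !ltW.
have := convex_function_conv_le y z fc s01'.
have : 0 <= mu / 2 * (s * (1 - s)) * enorm (y - z) ^+ 2.
  by rewrite mulr_ge0 ?sqr_ge0 // !mulr_ge0 ?subr_ge0 ?invr_ge0 ?ltW.
lra.
Qed.

Let S t := \sum_(1 <= k < t.+1) w k.

Let avg t := (S t)^-1 *: \sum_(1 <= k < t.+1) w k *: x k.+1.

Let S_gt0 t : (0 < t)%N -> 0 < S t.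
Proof.
case: t => // t _; rewrite /S big_nat_recr //= ltr_wpDl // sumr_ge0 // => k _.
exact: ltW.
Qed.

Let F_avg_le t : (0 < t)%N ->
  ((f (avg t))%:E + G (avg t)
    <= ((S t)^-1 * \sum_(1 <= k < t.+1) w k * Fr (x k.+1))%:E)%E.
Proof.
move=> t0.
apply: (@jensen_sum _ _ (fun z => (f z)%:E + G z)%E w (fun k => Fr (x k.+1))
  (fun k => x k.+1) t) => //.
by move=> k k1; rewrite /Fr EFinD fineK // Gx.
Qed.

(** The Jensen bound excludes the value +oo, and [GNy] excludes -oo. *)
Lemma admm_average_fin_num t : (0 < t)%N -> G (avg t) \is a fin_num.
Proof.
move=> t0; rewrite fin_numE gt_eqF ?GNy //=.
have := F_avg_le t0; case: (G (avg t)) => //.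
Qed.

(** Jensen handles the objective, while the residual is affine and averages exactly. The residual
    squares and the final energy are nonnegative and dropped. *)
Lemma admm_ergodic t l : (0 < t)%N ->
  Fr (avg t) - Fr xs - inner l (A *m avg t - b) <= (S t)^-1 * E 1 l.
Proof.
move=> t0; have St := S_gt0 t0.
have tel := admm_telescope t l.
have h := F_avg_le t0.
rewrite -(fineK (admm_average_fin_num t0)) -EFinD lee_fin in h.
rewrite -/(Fr _) mulrC ler_pdivlMr // in h.
rewrite mulrC ler_pdivlMr //; apply: le_trans tel.
have E0 : 0 <= E t.+1 l.
  apply: le_trans (E_ge l (ltn0Sn t)).
  by rewrite mulr_ge0 // divr_ge0 // mulr_ge0 // ltW.
have AE : (A *m avg t - b) = (S t)^-1 *: \sum_(1 <= k < t.+1) w k *: r k.+1.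
  have -> : b = (S t)^-1 *: \sum_(1 <= k < t.+1) w k *: b.
    by rewrite -scaler_suml scalerA mulVf ?scale1r // gt_eqF.
  rewrite /avg -scalemxAr mulmx_sumr -scalerBr -sumrB.
  by congr (_ *: _); apply: eq_bigr => k _; rewrite -scalemxAr -scalerBr.
have IE : inner l (A *m avg t - b) * S t
    = \sum_(1 <= k < t.+1) w k * inner l (r k.+1).
  rewrite AE innerZr mulrC mulVKf ?gt_eqF // innerC /inner linear_sum /=.
  rewrite mulmx_suml summxE; apply: eq_bigr => k _.
  by rewrite linearZ /= -scalemxAl mxE -/(inner _ _) innerC.
have : 0 <= \sum_(1 <= k < t.+1) k%:R * w k / 2 * (beta * enorm (r k.+1) ^+ 2).
  rewrite sumr_ge0 // => k _; apply: mulr_ge0.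
    by rewrite divr_ge0 // mulr_ge0 // ltW.
  by rewrite mulr_ge0 ?sqr_ge0 // ltW.
rewrite big_split /= !mulrBl IE.
under [in X in _ -> _ <= X]eq_bigr do rewrite !mulrBr.
rewrite !sumrB -mulr_suml -/(S t).
move: h E0; rewrite [S t * Fr xs]mulrC; lra.
Qed.

End Rate.

(** * Block decomposition *)

Section Blocks.
Context {R : realType} {M : nat} {n : 'I_M -> nat}.
Implicit Types (u v z : 'cV[R]_(\sum_i n i)).

Lemma inner_blocks u v :
  inner u v = \sum_i inner (submxcol u i) (submxcol v i).
Proof.
rewrite -[in LHS](submxcolK u) -[in LHS](submxcolK v) /inner tr_mxcol.
by rewrite mul_mxrow_mxcol summxE.
Qed.

Lemma wnorm2_mxdiag (W : forall i, 'M[R]_(n i)) v :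
  wnorm2 (\mxdiag_i W i) v = \sum_i wnorm2 (W i) (submxcol v i).
Proof.
rewrite wnorm2E inner_blocks -[in X in _ *m X](submxcolK v) mul_mxdiag_mxcol.
by apply: eq_bigr => i _; rewrite mxcolK wnorm2E.
Qed.

Lemma wnorm2_mxdiag_affine (W : forall i, 'M[R]_(n i)) (a c : R) v :
  wnorm2 (\mxdiag_i (a *: W i + c%:M)) v =
  wnorm2 (a *: (\mxdiag_i W i) + c%:M) v.
Proof.
rewrite wnorm2_affine !wnorm2_mxdiag inner_blocks !mulr_sumr -big_split /=.
by apply: eq_bigr => i _; exact: wnorm2_affine.
Qed.

(** The objective splits into one summand per block, so blockwise minimality adds up to joint
    minimality. *)
Lemma argmin_blocks (g : forall i, 'cV[R]_(n i) -> \bar R)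
    (W : forall i, 'M[R]_(n i)) (c z0 z : 'cV[R]_(\sum_i n i)) :
  (forall i, argmin (fun y => (inner (submxcol c i) y)%:E + g i y
     + (1 / 2 * wnorm2 (W i) (y - submxcol z0 i))%:E)%E (submxcol z i)) ->
  argmin (fun y => (inner c y)%:E + sepsum g y
     + (1 / 2 * wnorm2 (\mxdiag_i W i) (y - z0))%:E)%E z.
Proof.
move=> zmin y.
have split_blocks u : ((inner c u)%:E + sepsum g u
     + (1 / 2 * wnorm2 (\mxdiag_i W i) (u - z0))%:E =
    \sum_i ((inner (submxcol c i) (submxcol u i))%:E + g i (submxcol u i)
     + (1 / 2 * wnorm2 (W i) (submxcol u i - submxcol z0 i))%:E))%E.
  rewrite !big_split /= !sumEFin -inner_blocks -mulr_sumr wnorm2_mxdiag.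
  congr (_ + (_ * _)%:E)%E.
  by apply: eq_bigr => i _; rewrite -submxcolB.
by rewrite !split_blocks; apply: lee_sum => i _; exact: zmin.
Qed.

Lemma sepsum_gtNy (g : forall i, 'cV[R]_(n i) -> \bar R) z :
  (forall i, proper_fun (g i)) -> (-oo < sepsum g z)%E.
Proof.
move=> gp; apply: (big_ind (fun a : \bar R => (-oo < a)%E)) => // [|i _].
  by move=> [a| |] [c| |] // _ _; rewrite -EFinD ltNyr.
by have [] := gp i.
Qed.

Lemma argmin_fin_num p (h : 'cV[R]_p -> \bar R) (q1 q2 : 'cV[R]_p -> R)
    (z : 'cV[R]_p) :
  proper_fun h ->
  argmin (fun y => (q1 y)%:E + h y + (q2 y)%:E)%E z -> h z \is a fin_num.
Proof.
move=> [hNy [y hy]] /(_ y) /=.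
have := hNy z; have := hNy y; case: (h z) (h y) hy => [a| |] [c| |] //.
Qed.

Lemma sepsum_fin_num (g : forall i, 'cV[R]_(n i) -> \bar R) z :
  (forall i, g i (submxcol z i) \is a fin_num) -> sepsum g z \is a fin_num.
Proof.
move=> gz; apply: (big_ind (fun a : \bar R => a \is a fin_num)) => //.
by move=> a c a0 c0; rewrite fin_numD a0.
Qed.

End Blocks.

(** * Sum of the weights and assembly of the rates *)

Lemma sum_weights (R : realType) (a : R) t :
  \sum_(1 <= k < t.+1) (k%:R + a + 1) = t%:R * (t%:R + 2 * a + 3) / 2.
Proof.
elim: t => [|t IH]; first by rewrite big_geq // !mul0r.
by rewrite big_nat_recr //= IH -natr1; field.
Qed.

Theorem theorem2p3 (R : realType) (M m : nat) (n : 'I_M -> nat)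
    (f : 'cV[R]_(\sum_i n i) -> R) (g : forall i, 'cV[R]_(n i) -> \bar R)
    (A_ : forall i, 'M[R]_(m, n i)) (b : 'cV[R]_m)
    (Lf mu beta : R) (P_ : forall i, 'M[R]_(n i))
    (xs : 'cV[R]_(\sum_i n i)) (lams : 'cV[R]_m)
    (x : nat -> 'cV[R]_(\sum_i n i)) (lam : nat -> 'cV[R]_m) :
  let A := \mxrow_i A_ i in
  let P := \mxdiag_i P_ i in
  let F := objective f g in
  let r := residual A b x in
  let betak := fun k : nat => k%:R * beta in
  let rhok := fun k : nat => k%:R * beta in
  let Pk_ := fun (k : nat) i => k%:R *: P_ i + Lf%:M in
  let Pk := fun k : nat => \mxdiag_i Pk_ k i in
  convex_function setT f ->
  (forall z, differentiable f z) ->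
  lipschitz_grad f Lf ->
  (forall i, [/\ proper_fun (g i), closed_fun (g i) & econvex_fun (g i)]) ->
  0 < mu ->
  strongly_convex_fun mu (sepsum g) ->
  kkt_point F A b xs lams ->
  0 < beta ->
  P^T = P ->
  lt_mx 0 (P - beta *: (A^T *m A)) ->
  le_mx (P - beta *: (A^T *m A)) (mu / 2)%:M ->
  proximal_jacobian_admm f g A_ b betak rhok Pk_ x lam ->
  let k0 := 2 * Lf / mu in
  let phi1 := fun (z : 'cV[R]_(\sum_i n i)) (l : 'cV[R]_m) =>
    (k0 + 2) / (2 * rhok 1%N) * enorm (l - lam 1%N) ^+ 2
    + (k0 + 2) / 2 * wnorm2 (Pk 1%N - betak 1%N *: (A^T *m A)) (x 1%N - z) in
  let gamma := Num.max (2 * enorm lams) (1 + enorm lams) in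
  forall t : nat, (1 <= t)%N ->
    Num.max (beta * enorm (r t.+1) ^+ 2)
            (wnorm2 (P - beta *: (A^T *m A)) (x t.+1 - xs))
      <= 2 / (t%:R * (t%:R + k0 + 1)) * phi1 xs lams
    /\
    let T := t%:R * (t%:R + 2 * k0 + 3) / 2 in
    let xbar := T^-1 *: \sum_(1 <= k < t.+1) (k%:R + k0 + 1) *: x k.+1 in
    exists phimax : R,
      [/\ is_max [set phi1 xs l | l in [set l | enorm l <= gamma]] phimax,
          (`|F xbar - F xs| <= (1 / T * phimax)%:E)%E &
          enorm (A *m xbar - b)
            <= 1 / (T * Num.max 1 (enorm lams)) * phimax].
Proof.
move=> A P F r betak rhok Pk_ Pk fc fd fL gp mu0 Gc [[v vsub vE] Axs] beta0 PT
  [_ Qpos] [_ Qmu] [lam1 xmin lamE] k0 phi1 gamma t t1.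
have gpr i : proper_fun (g i) by have [] := gp i.
have GNy z := sepsum_gtNy z gpr.
have Q0 z : 0 <= wnorm2 (P - beta *: (A^T *m A)) z.
  have [->|z0] := eqVneq z 0; first by rewrite /wnorm2 mulmx0 mxE.
  by have := Qpos z z0; rewrite subr0 => /ltW.
have Qmu' z : wnorm2 (P - beta *: (A^T *m A)) z <= mu / 2 * inner z z.
  have := Qmu z; rewrite !wnorm2E mulmxBl mul_scalar_mx innerDr innerNr innerZr.
  by rewrite subr_ge0.
have Gx k : (0 < k)%N -> sepsum g (x k.+1) \is a fin_num.
  by move=> k1; apply: sepsum_fin_num => i; exact: argmin_fin_num (xmin k k1 i).
have xmin' k : (0 < k)%N -> argmin (fun z =>
    (inner (grad f (x k) - A^T *m (lam k - (k%:R * beta) *: (A *m x k - b)))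
       z)%:E
    + sepsum g z + (1 / 2 * wnorm2 (k%:R *: P + Lf%:M) (z - x k))%:E)%E
    (x k.+1).
  move=> k1 y; rewrite /P -!wnorm2_mxdiag_affine.
  move: y; apply: argmin_blocks => i; have := xmin k k1 i.
  by rewrite submxcolB -submxcol_mul tr_mxrow mxcolK.
have vA : v = A^T *m lams by apply/eqP; rewrite -subr_eq0 vE.
have kkt z : (F xs + (inner lams (A *m z - b))%:E <= F z)%E.
  by have := vsub z; rewrite vA innerC -inner_mull mulmxBr Axs innerC.
(* An infinite value at [xs] would contradict the KKT inequality at [x 2], where the objective is
   finite. *)
have Gxs : sepsum g xs \is a fin_num.
  rewrite fin_numE gt_eqF ?GNy //=.
  have := kkt (x 2%N); rewrite /F /objective.
  have := Gx 1%N isT; case: (sepsum g (x 2%N)) => // a _.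
  by case: (sepsum g xs).
have kkt' z : ((f xs + fine (sepsum g xs))%:E + (inner lams (A *m z - b))%:E
    <= (f z)%:E + sepsum g z)%E.
  by rewrite EFinD fineK //; exact: kkt.
have [L0 _] := fL.
have k00 : 0 <= k0 by rewrite /k0 divr_ge0 ?mulr_ge0 // ltW.
have tR : 0 < t%:R :> R by rewrite ltr0n.
(* P^1 - beta_1 A^T A equals [Q] plus [Lf] times the identity, and w_1 = k0 + 2, so [phi1] is the
   initial energy. *)
have phiE l : phi1 xs l =
    (1 + k0 + 1) / (2 * (1 * beta)) * enorm (l - lam 1%N) ^+ 2
    + (1 + k0 + 1) / 2
      * wnorm2 (1 *: (P - beta *: (A^T *m A)) + Lf%:M) (x 1%N - xs).
  rewrite /phi1 /Pk /betak /rhok wnorm2B wnorm2_mxdiag_affine !wnorm2_affine.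
  rewrite -/P wnorm2B !mul1r [1 + k0 + 1]addrAC (addrC (1 + 1)).
  by congr (_ + _ * _); rewrite addrAC.
split.
  rewrite phiE.
  exact: (admm_nonergodic_rate fc fd fL mu0 Gc beta0 PT Q0 Qmu' Axs Gxs Gx kkt'
    xmin' lamE t1).
move=> T xbar.
have T0 : 0 < T by rewrite /T divr_gt0 // mulr_gt0 //; lra.
have TE : \sum_(1 <= k < t.+1) (k%:R + k0 + 1) = T by exact: sum_weights.
have Gbar : sepsum g xbar \is a fin_num.
  have := admm_average_fin_num fc fL mu0 Gc Gx GNy t1.
  by rewrite /= -/k0 TE.
have gap l : f xbar + fine (sepsum g xbar) - (f xs + fine (sepsum g xs))
    - inner l (A *m xbar - b) <= T^-1 * phi1 xs l.
  have := admm_ergodic fc fd fL mu0 Gc beta0 PT Q0 Qmu' Axs Gxs Gx xmin' lamE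
    GNy l t1.
  by rewrite /= -/k0 TE phiE.
have gamma0 : 0 <= gamma by rewrite /gamma le_max mulr_ge0 ?enorm_ge0.
have [lmax lmax_le lmaxP] := exists_enorm_max m gamma0.
(* Since [lam 1] is 0, [phi1] depends on [l] only through its norm and increases with it. *)
have phi_max l : enorm l <= gamma -> phi1 xs l <= phi1 xs lmax.
  move=> lg; rewrite /phi1 lam1 !subr0 lerD2r ler_wpM2l //.
    by rewrite divr_ge0 ?addr_ge0 // /rhok !mulr_ge0 // ltW.
  by rewrite ler_sqr ?nnegrE ?enorm_ge0 // lmaxP.
have [] := @saddle_gap_bounds _ _ (A *m xbar - b) lams
  (f xbar + fine (sepsum g xbar) - (f xs + fine (sepsum g xs)))
  (T^-1 * phi1 xs lmax).
- move=> l lg; apply: (le_trans (gap l)).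
  by rewrite ler_wpM2l ?invr_ge0 ?phi_max // ltW.
- have := kkt' xbar; rewrite -(fineK Gbar) -!EFinD lee_fin; lra.
move=> Fgap Agap; exists (phi1 xs lmax); split.
- split; first by exists lmax.
  by move=> _ [l lg <-]; exact: phi_max.
- rewrite /F /objective -(fineK Gbar) -(fineK Gxs) -!EFinD.
  by rewrite abse_EFin lee_fin div1r.
have M0 : 0 < Num.max 1 (enorm lams) by rewrite lt_max ltr01.
by rewrite div1r invfM mulrAC ler_pdivlMr.
Qed.
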